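(* Let $d \ge 1$ be an integer, let $h \in \mathcal{H}$, and let $n = h+d$. If \[ h \ge h_0(d) := \left(e\,(\pi/2)^{d/2}\,(d-1)! + d\right)^2, \] then \[ \frac{D(n)}{h^{h/2}} > \left(\frac{2n}{\pi}\right)^{d/2}. \]
   Context: A Hadamard matrix of order $h$ is an $h\times h$ matrix $H$ with entries in $\{\pm1\}$ satisfying $HH^T = hI$. $\mathcal{H}$ denotes the set of positive integers $h$ for which a Hadamard matrix of order $h$ exists. $D(n)$ denotes the maximal determinant of an $n\times n$ matrix with entries in the real interval $[-1,1]$. *)

(* Defs.v *)
From HB Require Import structures.
From mathcomp Require Import all_boot all_order all_fingroup all_algebra.
From mathcomp Require Import all_classical all_reals all_analysis.
Set Implicit Arguments.
Unset Strict Implicit.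
Unset Printing Implicit Defensive.
Import Order.TTheory GRing.Theory Num.Theory.
Import numFieldNormedType.Exports.
Local Open Scope classical_set_scope.
Local Open Scope ring_scope.

Definition hadamard (h : nat) (H : 'M[int]_h) : Prop :=
  (forall i j, H i j = 1 \/ H i j = -1) /\ H *m H^T = (h%:R)%:M.

Definition hadamard_order (h : nat) : Prop :=
  (0 < h)%N /\ exists H : 'M[int]_h, hadamard H.

Definition unit_box (R : realType) (n : nat) : set 'M[R]_n :=
  [set A | forall i j, -1 <= A i j <= 1].

Definition maxdet (R : realType) (n : nat) : R :=
  sup [set \det A | A in @unit_box R n].

(* The factorial of d - 1 is only meaningful for d >= 1. *)
Definition h0 (R : realType) (d : nat) : R :=
  (expR 1 * (pi / 2) `^ (d%:R / 2) * (d.-1)`!%:R + d%:R) ^+ 2.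

(* The supremum defining maxdet is a maximum. *)
Lemma maxdet_max (R : realType) (n : nat) :
  (exists2 A : 'M[R]_n, unit_box A & \det A = maxdet R n) /\
  (forall A : 'M[R]_n, unit_box A -> \det A <= maxdet R n).
Proof.
pose box := [set v : 'rV[R]_(n * n) | forall i, `[-1, 1]%classic (v ord0 i)].
have boxP (v : 'rV[R]_(n * n)) : box v <-> unit_box (vec_mx v).
  split=> [bv i j|bv k]; first by have := bv (mxvec_index i j); rewrite mxE /= in_itv.
  by case/mxvec_indexP: k => i j; rewrite /= in_itv /=; have := bv i j; rewrite mxE.
have [|||v vbox vmax] := @EVT_max_rV R _ (fun v => \det (vec_mx v)) box.
- by exists 0 => i; rewrite /= in_itv /= mxE lerN10 ler01.
- by apply: (@rV_compact R _ (fun=> `[-1, 1]%classic)) => _; exact: segment_compact.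
- apply: continuous_subspaceT.
  apply: continuous_big => [|s _]; first exact: (@add_continuous R^o).
  move=> w; apply: (@cvgM R _ (nbhs w) _ (fun=> (-1) ^+ odd_perm s)); first exact: cvg_cst.
  move: w; apply: continuous_big => [|i _]; first exact: (@mul_continuous R).
  rewrite (_ : (fun _ => _) = (fun w : 'rV[R]_(n * n) => w ord0 (mxvec_index i (s i)))).
    exact: coord_continuous.
  by apply/funext => w; rewrite mxE.
have ub : ubound [set \det A | A in @unit_box R n] (\det (vec_mx v)).
  move=> _ [A Abox <-]; rewrite -(mxvecK A); apply: vmax; rewrite inE.
  by apply/boxP; rewrite mxvecK.
have vin : unit_box (vec_mx v) by apply/boxP; rewrite inE in vbox.
have im_v : [set \det A | A in @unit_box R n] (\det (vec_mx v)).
  by exists (vec_mx v).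
have <- : \det (vec_mx v) = maxdet R n.
  apply/eqP; rewrite eq_le; apply/andP; split; last first.
    by apply: ge_sup ub; exists (\det (vec_mx v)).
  by apply: ub_le_sup im_v; exists (\det (vec_mx v)).
split; first by exists (vec_mx v).
by move=> A Abox; apply: ub; exists A.
Qed.

(* Main.v *)
Require Import Defs.
From mathcomp Require Import all_boot all_order all_fingroup all_algebra.
From mathcomp Require Import all_classical all_reals all_analysis.
From mathcomp Require Import ring lra zify.
Set Implicit Arguments.
Unset Strict Implicit.
Unset Printing Implicit Defensive.
Import Order.TTheory GRing.Theory Num.Theory.
Import numFieldNormedType.Exports.
Local Open Scope ring_scope.

(* Border a Hadamard matrix A by a uniformly random sign matrix B on the right,
   by -C with C = sgn((A^T B)^T) below, and by the identity in the corner.  The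
   Schur complement is I + F with F = C A^-1 B, whose diagonal entries are
   independent with mean E|S_h| >= h sqrt(2 / (pi (h + 1))), S_h a sum of h
   random signs (the bound is Wallis' inequality),
   whose entries are bounded by sqrt h, and whose off-diagonal entries have
   second moment at most 1.  In the Leibniz expansion of E det(I + F) the
   identity contributes at least (1 + E|S_h|)^d, and every other permutation
   moves two indices, hence contributes at most (1 + sqrt h)^(d-2) in absolute
   value.  The assumption on h makes the first term dominate, and the 1 on the
   diagonal compensates for passing from h to n = h + d. *)

(** * Wallis' inequality and the mean of |S_h| *)

Section Wallis.
Variable R : realType.

(** The integral of [sin ^+ n] over [0, pi/2] is [v], stated through a primitive so that
    monotonicity alone compares two such integrals. *)
Definition primitive_sin_pow (n : nat) (v : R) : Prop :=
  exists J : R -> R,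
    [/\ forall x : R, is_derive x 1 J (sin x ^+ n), J 0 = 0 & J (pi / 2) = v].

(** Integration by parts: the boundary term [cos * sin ^+ n.+1] vanishes at both ends. *)
Lemma primitive_sin_powSS n v : primitive_sin_pow n v ->
  primitive_sin_pow n.+2 (n.+1%:R / n.+2%:R * v).
Proof.
case=> J [dJ J0 Jv].
pose K : R -> R := n.+2%:R^-1 \*: (n.+1%:R \*: J - cos * sin ^+ n.+1).
have KE y : K y = n.+2%:R^-1 * (n.+1%:R * J y - cos y * sin y ^+ n.+1).
  by rewrite -[sin y ^+ n.+1]/((fun y => sin y ^+ n.+1) y) -exprfctE.
exists K; split=> [x||]; last 2 first.
- by rewrite KE J0 sin0 expr0n /= !mulr0 subrr mulr0.
- by rewrite KE Jv cos_pihalf mul0r subr0 mulrA [_^-1 * _]mulrC.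
have /= dsX := is_deriveX n.+1 (is_derive_sin x).
have /= dP := is_deriveM (is_derive_cos x) dsX.
have dS := is_deriveZ n.+2%:R^-1 (is_deriveB (is_deriveZ n.+1%:R (dJ x)) dP).
apply: (@is_derive_eq _ _ _ _ _ _ _ _ dS); rewrite /GRing.scale /= !fctE.
have c2 : cos x * cos x = 1 - sin x ^+ 2 by rewrite -(cos2Dsin2 x); ring.
have nz : n.+2%:R != 0 :> R by rewrite pnatr_eq0.
apply: (mulfI nz); rewrite mulVKf//.
rewrite !exprS -[n.+2%:R]natr1; set N := n.+1%:R; set p := sin x ^+ n.
by transitivity (N * p - (cos x * cos x * (N * p) - sin x * p * sin x));
  [ring | rewrite c2; ring].
Qed.

(** The probability that [m.*2] fair random signs sum to 0; up to the factor pi/2 it is also the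
    even Wallis integral. *)
Definition central_bin (m : nat) : R := 'C(m.*2, m)%:R / 4 ^+ m.

Lemma bin_centralS m :
  (m.+1 * 'C(m.+1.*2, m.+1) = 2 * (m.*2.+1 * 'C(m.*2, m)))%N.
Proof.
rewrite doubleS -(mul_bin_diag m.*2.+2) /= -doubleS -muln2 mulnC.
rewrite (_ : 'C(m.*2.+1, m) = 'C(m.*2.+1, m.+1))%N; last first.
  by rewrite -bin_sub; [congr binomial | ]; lia.
by rewrite (mul_bin_diag m.*2.+1 m); lia.
Qed.

Lemma central_binS m :
  m.*2.+2%:R * central_bin m.+1 = m.*2.+1%:R * central_bin m.
Proof.
have e : m.+1%:R * 'C(m.+1.*2, m.+1)%:R =
    2 * (m.*2.+1%:R * 'C(m.*2, m)%:R) :> R by rewrite -!natrM bin_centralS.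
have -> : m.*2.+2%:R = 2 * m.+1%:R :> R by rewrite -natrM; congr (_%:R); lia.
rewrite /central_bin exprS.
have nz : 4 ^+ m != 0 :> R by rewrite expf_neq0.
transitivity (m.+1%:R * 'C(m.+1.*2, m.+1)%:R * 2 / (4 * 4 ^+ m) : R); first by field.
by rewrite e; field.
Qed.

Lemma central_bin_gt0 m : 0 < central_bin m.
Proof. by rewrite divr_gt0 ?exprn_gt0// ltr0n bin_gt0; lia. Qed.

Lemma primitive_sin_pow_even m :
  primitive_sin_pow m.*2 (pi / 2 * central_bin m).
Proof.
elim: m => [|m /primitive_sin_powSS].
  exists id; split=> //; last by rewrite /central_bin bin0 expr0 divr1 mulr1.
  by move=> x; rewrite expr0; exact: is_derive_id.
rewrite mulrCA; congr primitive_sin_pow; congr (_ * _).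
have nz : m.*2.+2%:R != 0 :> R by rewrite pnatr_eq0.
by apply: (mulfI nz); rewrite central_binS; field.
Qed.

Lemma primitive_sin_pow_odd m :
  primitive_sin_pow m.*2.+1 (m.*2.+1%:R * central_bin m)^-1.
Proof.
elim: m => [|m /primitive_sin_powSS].
  exists (fun x => 1 - cos x); split.
  - move=> x; have /= d := is_deriveB (is_derive_cst (1 : R) x 1) (is_derive_cos x).
    by apply: is_derive_eq d _; rewrite sub0r opprK.
  - by rewrite cos0 subrr.
  - by rewrite cos_pihalf /central_bin bin0 expr0 divr1 mulr1 invr1 subr0.
congr primitive_sin_pow; rewrite -central_binS doubleS.
have nz : m.*2.+2%:R != 0 :> R by rewrite pnatr_eq0.
have nz3 : m.*2.+3%:R != 0 :> R by rewrite pnatr_eq0.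
have := central_bin_gt0 m.+1; rewrite lt0r => /andP[q0 _].
by field; rewrite -!natrD q0 nz nz3.
Qed.

(** Since 0 <= sin <= 1 on [0, pi/2], the integral of [sin ^+ m.*2.+1] is at most that of
    [sin ^+ m.*2]; inserting both Wallis values gives the bound. *)
Lemma central_bin_ge m : 2 / (pi * m.*2.+1%:R) <= central_bin m ^+ 2.
Proof.
have [J [dJ J0 Jv]] := primitive_sin_pow_even m.
have [K [dK K0 Kv]] := primitive_sin_pow_odd m.
have pi0 : 0 < pi :> R := pi_gt0 R.
have dD (x : R) : is_derive x 1 (J - K) (sin x ^+ m.*2 - sin x ^+ m.*2.+1).
  by exact: is_deriveB.
have : (J - K) 0 <= (J - K) (pi / 2).
  have pih : 0 <= pi / 2 :> R by lra.
  apply: (@ger0_derive1_le_cc R (J - K) 0 (pi / 2)).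
  - by move=> x _; exact: @ex_derive _ _ _ _ _ _ _ (dD x).
  - move=> x; rewrite in_itv /= => /andP[x0 xp].
    rewrite derive1E (@derive_val _ _ _ _ _ _ _ (dD x)) subr_ge0 exprS.
    by rewrite ler_piMl ?sin_le1// exprn_ge0// sin_ge0_pi// (ltW x0); lra.
  - apply: derivable_within_continuous => x _.
    exact: @ex_derive _ _ _ _ _ _ _ (dD x).
  - by rewrite in_itv /= lexx pih.
  - by rewrite in_itv /= lexx pih.
  - by [].
rewrite !fctE J0 K0 Jv Kv subrr subr_ge0.
have : 0 < m.*2.+1%:R :> R by rewrite ltr0n.
move: (central_bin_gt0 m) (m.*2.+1%:R) => + N; move: (central_bin m) => q q0 N0 le.
move: pi pi0 le => P P0 le.
have -> : 2 / (P * N) = (N * q)^-1 * (2 / P * q) by field; rewrite !gt_eqF.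
have -> : q ^+ 2 = P / 2 * q * (2 / P * q) by field; rewrite gt_eqF.
by rewrite ler_wpM2r// ltW// mulr_gt0// divr_gt0.
Qed.

End Wallis.

Section Rademacher.

(** The sum telescopes: the k-th term equals (k+1) C(h, k+1) - k C(h, k). *)
Lemma partial_sum_bin (h j : nat) :
  \sum_(k < j) ('C(h, k)%:R * (h%:R - k.*2%:R)) = (j * 'C(h, j))%:R :> int.
Proof.
elim: j => [|j IH]; first by rewrite big_ord0.
rewrite big_ord_recr /= IH mul_bin_left.
have [jh|hj] := leqP j h; last by rewrite bin_small//= !muln0 mul0r addr0.
by rewrite !natrM natrB// -muln2 natrM; ring.
Qed.

(* Counting the terms k < j with sign + and the others with sign - bounds the
   sum of absolute values from below; the bound is sharp at j = ceil(h / 2). *)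
Lemma sum_bin_dist_ge (h j : nat) : (j <= h.+1)%N ->
  (2 * (j * 'C(h, j)))%:R <=
  \sum_(k < h.+1) ('C(h, k)%:R * `|h%:R - k.*2%:R|) :> int.
Proof.
move=> jh; pose F k : int := 'C(h, k)%:R * (h%:R - k.*2%:R).
have tot : \sum_(0 <= k < h.+1) F k = 0.
  by rewrite big_mkord partial_sum_bin bin_small// muln0.
have low : \sum_(0 <= k < j) F k = (j * 'C(h, j))%:R.
  by rewrite big_mkord partial_sum_bin.
rewrite -(big_mkord xpredT (fun k => 'C(h, k)%:R * `|h%:R - k.*2%:R|)).
have high : \sum_(j <= k < h.+1) F k = - (j * 'C(h, j))%:R.
  by apply/eqP; rewrite -addr_eq0 addrC -low -big_cat_nat// tot.
rewrite (@big_cat_nat _ _ _ j 0 h.+1)//= natrM mulr_natl mulr2n.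
apply: lerD.
  by rewrite -low; apply: ler_sum => k _; rewrite ler_wpM2l// ler_norm.
rewrite -[leLHS]opprK -high -sumrN; apply: ler_sum => k _.
by rewrite -mulrN ler_wpM2l// -normrN ler_norm.
Qed.

Variable R : realType.

Lemma sum_bin_dist_central (h : nat) :
  h%:R * central_bin R h./2 * 2 ^+ h <=
  \sum_(k < h.+1) ('C(h, k)%:R * `|h%:R - k.*2%:R|) :> R.
Proof.
(* The index j = [h./2 + odd h] is ceil(h / 2); the power of 2 accounts for 2^h against 4^[h./2]
   when h is odd. *)
have key : (h * 'C(h./2.*2, h./2) * 2 ^ odd h =
    2 * ((h./2 + odd h) * 'C(h, h./2 + odd h)))%N.
  move: (odd h) (h./2) (odd_double_half h) => [] m <-.
    by rewrite add1n addn1 -(mul_bin_diag m.*2.+1 m) expn1 /= mulnC.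
  by rewrite add0n addn0 expn0 muln1 -mul2n mulnA.
have pow : 2 ^+ h = 2 ^+ odd h * 4 ^+ h./2 :> R.
  rewrite -[in LHS](odd_double_half h) exprD -mul2n exprM.
  by rewrite (_ : 2 ^+ 2 = 4) //; ring.
have -> : h%:R * central_bin R h./2 * 2 ^+ h =
    (2 * ((h./2 + odd h) * 'C(h, h./2 + odd h)))%:R :> R.
  rewrite -key pow !natrM natrX /central_bin.
  have nz : 4 ^+ h./2 != 0 :> R by rewrite expf_neq0.
  by field.
have jh : (h./2 + odd h <= h.+1)%N by have := odd_double_half h; lia.
have := sum_bin_dist_ge jh; rewrite -(ler_int R) !rmorph_nat => /le_trans -> //.
rewrite rmorph_sum le_eqVlt; apply/orP; left; apply/eqP; apply: eq_bigr => k _.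
by rewrite rmorphM /= intr_norm rmorphB /= !rmorph_nat.
Qed.

(** A sign vector is the set of its minus signs; k of them give the sum h - 2k, and there are C(h,
    k) such sets. *)
Lemma sum_abs_rademacher (h : nat) :
  \sum_(b : {ffun 'I_h -> bool}) `|\sum_i (-1) ^+ b i| =
  \sum_(k < h.+1) ('C(h, k)%:R * `|h%:R - k.*2%:R|) :> R.
Proof.
have val (A : {set 'I_h}) : \sum_i (-1) ^+ (i \in A) = h%:R - #|A|.*2%:R :> R.
  rewrite (bigID (mem A)) /= (eq_bigr (fun=> -1)) => [|i ->//].
  rewrite [X in _ + X](eq_bigr (fun=> 1)) => [|i /negbTE->//].
  have -> : h%:R = #|A|%:R + #|[predC A]|%:R :> R by rewrite -natrD cardC card_ord.
  by rewrite !sumr_const -addnn natrD mulNrn; ring.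
pose f (A : {set 'I_h}) : {ffun 'I_h -> bool} := [ffun i => i \in A].
have fbij : bijective f.
  exists (fun b : {ffun 'I_h -> bool} => [set i | b i]).
    by move=> A; apply/setP => i; rewrite !inE ffunE.
  by move=> b; apply/ffunP => i; rewrite !ffunE inE.
rewrite (reindex f) /=; last exact: onW_bij.
pose c (A : {set 'I_h}) : 'I_h.+1 := inord #|A|.
have cE A : c A = #|A| :> nat.
  by rewrite inordK// ltnS -[leqRHS]card_ord max_card.
rewrite (partition_big c xpredT)//=; apply: eq_bigr => k _.
rewrite (eq_bigr (fun=> `|h%:R - k.*2%:R|)) => [|A /eqP <-].
  rewrite sumr_const mulr_natl -[X in 'C(X, k)]card_ord -card_draws.
  by congr (_ *+ _); apply: eq_card => A; rewrite [RHS]inE -cE.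
by rewrite cE -val; congr `|_|; apply: eq_bigr => i _; rewrite ffunE.
Qed.

(** Fixed signs [p], later a column of the Hadamard matrix, do not change the mean: xor with [p]
    permutes the sign vectors. *)
Lemma mean_abs_rademacher (h : nat) (p : 'I_h -> bool) :
  2 ^+ h * (h%:R * Num.sqrt (2 / (pi * h.+1%:R))) <=
  \sum_(b : {ffun 'I_h -> bool}) `|\sum_i (-1) ^+ p i * (-1) ^+ b i| :> R.
Proof.
pose f (b : {ffun 'I_h -> bool}) := [ffun i => p i (+) b i].
have fK : involutive f by move=> b; apply/ffunP => i; rewrite !ffunE addKb.
rewrite (reindex_inj (inv_inj fK)) /=.
under eq_bigr => b _ do under eq_bigr => i _ do rewrite ffunE signr_addb signrMK.
rewrite sum_abs_rademacher; apply: le_trans (sum_bin_dist_central h).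
rewrite mulrC ler_wpM2r ?exprn_ge0// ler_wpM2l//.
have q0 : 0 <= central_bin R h./2 by exact/ltW/central_bin_gt0.
rewrite -[leRHS]ger0_norm// -sqrtr_sqr ler_wsqrtr//.
apply: le_trans (central_bin_ge _ _).
have pi0 := @pi_gt0 R.
rewrite ler_pM2l// lef_pV2 ?posrE ?mulr_gt0// ler_pM2l// ler_nat.
by have := odd_double_half h; lia.
Qed.

End Rademacher.

(** Up to scale A is an isometry. This serves for the Hadamard matrix and for its transpose. *)
Lemma sum_sqr_mulmx (R : comPzRingType) (m n : nat) (A : 'M[R]_(m, n)) (c : R)
    (u : 'rV[R]_m) : A *m A^T = c%:M ->
  \sum_k ((u *m A) 0 k) ^+ 2 = c * \sum_k (u 0 k) ^+ 2.
Proof.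
have dot p (v : 'rV[R]_p) : \sum_k (v 0 k) ^+ 2 = (v *m v^T) 0 0.
  by rewrite mxE; apply: eq_bigr => k _; rewrite mxE.
move=> AA; rewrite !dot trmx_mul mulmxA -(mulmxA u) AA mul_mx_scalar.
by rewrite -scalemxAl mxE.
Qed.

(* Flipping the sign [B j b] kills the cross terms; as i != j it does not affect
   the coefficients. *)
Lemma sum_sqr_sign_comb (R : realFieldType) (d h : nat) (i j : 'I_d)
    (w : {ffun 'I_h -> bool} -> 'I_h -> R) : i != j ->
  \sum_(B : {ffun 'I_d -> {ffun 'I_h -> bool}})
    (\sum_a w (B i) a * (-1) ^+ B j a) ^+ 2 =
  \sum_(B : {ffun 'I_d -> {ffun 'I_h -> bool}}) \sum_a w (B i) a ^+ 2.
Proof.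
move=> ij; under eq_bigr => B _ do rewrite expr2 mulr_suml.
rewrite exchange_big [RHS]exchange_big /=; apply: eq_bigr => a _.
under eq_bigr => B _ do rewrite mulr_sumr.
rewrite exchange_big (bigD1 a)//= [X in _ + X]big1 ?addr0 => [|b ba].
  apply: eq_bigr => B _; rewrite mulrACA -expr2 -expr2 -exprM mulnC exprM.
  by rewrite sqrrN expr1n expr1n mulr1.
pose flip (B : {ffun 'I_d -> {ffun 'I_h -> bool}}) :=
  [ffun l => [ffun k => B l k (+) ((l == j) && (k == b))]].
have flipK : involutive flip.
  by move=> B; apply/ffunP => l; apply/ffunP => k; rewrite !ffunE addbK.
have flipi B : flip B i = B i.
  by apply/ffunP => k; rewrite !ffunE (negbTE ij) addbF.
set s := \sum_B _; suff : s = - s by lra.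
rewrite {1}/s (reindex_inj (inv_inj flipK)) /= -sumrN; apply: eq_bigr => B _.
rewrite flipi !ffunE !eqxx /= eq_sym (negbTE ba) addbF addbT signrN.
by rewrite !mulrN.
Qed.

(** * The random border *)

Section RandomBorder.
Variables (R : realType) (d h : nat) (A : 'M[R]_h) (p : 'I_h -> 'I_h -> bool).
Hypothesis h_gt0 : (0 < h)%N.
Hypothesis A_sign : forall a k, A a k = (-1) ^+ p a k.
Hypothesis A_hadamard : A *m A^T = h%:R%:M.

Notation vec := {ffun 'I_h -> bool}.
Notation x := (Num.sqrt h%:R : R).

Let hR_gt0 : 0 < h%:R :> R. Proof. by rewrite ltr0n. Qed.

Definition signrow (S : vec) : 'rV[R]_h := \row_a (-1) ^+ S a.
Definition proj (S : vec) : 'rV[R]_h := signrow S *m A.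
Definition sgproj (S : vec) : 'rV[R]_h := \row_k Num.sg (proj S 0 k).
(* With b_i the i-th column of the border, [overlap b_i b_j] is the entry
   (i, j) of C A^-1 B, since A^-1 = A^T / h. *)
Definition overlap (S T : vec) : R := h%:R^-1 * (sgproj S *m (proj T)^T) 0 0.

Lemma hadamard_tr : A^T *m A = h%:R%:M.
Proof.
have : A *m (h%:R^-1 *: A^T) = 1%:M.
  by rewrite -scalemxAr A_hadamard scale_scalar_mx mulVf// gt_eqF.
move/mulmx1C; rewrite -scalemxAl => e.
by rewrite -[LHS](scalerKV (lt0r_neq0 hR_gt0)) e scale_scalar_mx mulr1.
Qed.

Lemma sum_sqr_proj S : \sum_k (proj S 0 k) ^+ 2 = h%:R * h%:R.
Proof.
rewrite (sum_sqr_mulmx _ A_hadamard); congr (_ * _).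
rewrite (eq_bigr (fun=> 1)) => [|k _]; first by rewrite sumr_const card_ord.
by rewrite mxE sqrr_sign.
Qed.

Lemma sgproj_le1 S k : `|sgproj S 0 k| <= 1.
Proof. by rewrite mxE normr_sg lern1 leq_b1. Qed.

Lemma sum_sqr_sgproj S : \sum_k (sgproj S 0 k) ^+ 2 <= h%:R.
Proof.
rewrite -[leRHS]mulr1 mulr_natl -[in leRHS](card_ord h) -sumr_const.
by apply: ler_sum => k _; rewrite -real_normK ?num_real// expr_le1// sgproj_le1.
Qed.

(** Cauchy-Schwarz for a vector of entries at most 1 in absolute value against one of squared norm
    h^2. *)
Lemma overlap_le S T : `|overlap S T| <= x.
Proof.
have x0 : 0 < x by rewrite sqrtr_gt0.
have xx : x ^+ 2 = h%:R by rewrite sqr_sqrtr// ltW.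
rewrite /overlap normrM ger0_norm ?invr_ge0// mulrC ler_pdivrMr//.
rewrite mxE (le_trans (ler_norm_sum _ _ _))//.
(* Termwise |y| <= x/2 + y^2/(2x); with the sum of the y^2 equal to h^2 = x^4, the right-hand sides
   add up to exactly x h. *)
have -> : x * h%:R = \sum_(k < h) (x / 2 + (2 * x)^-1 * (proj T 0 k) ^+ 2).
  rewrite big_split /= -[X in _ + X]mulr_sumr sum_sqr_proj.
  rewrite sumr_const card_ord -[(x / 2) *+ h]mulr_natr.
  by move: xx x0; move: x => y; move: (h%:R : R) => H <- y0; field; rewrite gt_eqF.
apply: ler_sum => k _; rewrite [_^T _ _]mxE normrM.
apply: (@le_trans _ _ `|proj T 0 k|).
  by rewrite ler_piMl// sgproj_le1.
rewrite -(real_normK (num_real (proj T 0 k))); set y := `|_|.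
rewrite -(ler_pM2l (_ : 0 < 2 * x)) ?mulr_gt0//.
have -> : 2 * x * (x / 2 + (2 * x)^-1 * y ^+ 2) = x ^+ 2 + y ^+ 2.
  by field; rewrite gt_eqF.
by rewrite -subr_ge0 (_ : _ - _ = (x - y) ^+ 2) ?sqr_ge0//; ring.
Qed.

(** Linear in the signs of [T] with coefficients depending on [S] only, the form needed by
    [sum_sqr_sign_comb]. *)
Lemma overlapE S T : overlap S T =
  \sum_a (h%:R^-1 * (sgproj S *m A^T) 0 a) * (-1) ^+ T a.
Proof.
rewrite /overlap /proj trmx_mul mulmxA mxE mulr_sumr.
by apply: eq_bigr => a _; rewrite mulrA [_^T _ _]mxE [signrow _ _ _]mxE.
Qed.

Lemma sum_sqr_overlap (i j : 'I_d) : i != j ->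
  \sum_(B : {ffun 'I_d -> vec}) (overlap (B i) (B j)) ^+ 2 <=
  #|{ffun 'I_d -> vec}|%:R.
Proof.
move=> ij; under eq_bigr => B _ do rewrite overlapE.
rewrite (sum_sqr_sign_comb (fun S a => h%:R^-1 * (sgproj S *m A^T) 0 a) ij).
rewrite -sumr_const; apply: ler_sum => B _.
under eq_bigr => a _ do rewrite exprMn.
rewrite -mulr_sumr (@sum_sqr_mulmx _ _ _ _ h%:R) ?trmxK ?hadamard_tr//.
rewrite expr2 mulrA -(mulrA h%:R^-1) mulVf ?gt_eqF// mulr1 mulrC ler_pdivrMr//.
by rewrite mul1r sum_sqr_sgproj.
Qed.

(** This is the reason for taking signs in [sgproj]: the diagonal becomes an l1 norm. *)
Lemma overlap_diag S : overlap S S = h%:R^-1 * \sum_k `|proj S 0 k|.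
Proof.
rewrite /overlap mxE; congr (_ * _); apply: eq_bigr => k _.
by rewrite [_^T _ _]mxE [sgproj _ _ _]mxE -normrEsg.
Qed.

(** Not the mean E|S_h| itself but its lower bound from Wallis' inequality. *)
Definition mean_diag : R := h%:R * Num.sqrt (2 / (pi * h.+1%:R)).

Lemma sum_overlap_diag : 2 ^+ h * mean_diag <= \sum_S overlap S S.
Proof.
under eq_bigr => S _ do rewrite overlap_diag.
rewrite -mulr_sumr [leRHS]mulrC ler_pdivlMr// exchange_big /=.
have -> : 2 ^+ h * mean_diag * h%:R = \sum_(k < h) 2 ^+ h * mean_diag.
  by rewrite sumr_const card_ord mulr_natr.
apply: ler_sum => k _; apply: le_trans (mean_abs_rademacher R (p ^~ k)) _.
apply: ler_sum => S _; rewrite le_eqVlt; apply/orP; left; apply/eqP.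
by congr `|_|; rewrite mxE; apply: eq_bigr => a _; rewrite mxE A_sign mulrC.
Qed.

Definition overlap_mx (B : {ffun 'I_d -> vec}) : 'M[R]_d :=
  \matrix_(i, j) overlap (B i) (B j).

Lemma card_borders : #|{ffun 'I_d -> vec}|%:R = (2 ^+ h) ^+ d :> R.
Proof. by rewrite !card_ffun !card_ord card_bool !natrX. Qed.

(** The i-th diagonal entry depends on [B i] alone, so the sum over all borders factors into d equal
    sums. *)
Lemma sum_prod_diag : (2 ^+ h) ^+ d * (1 + mean_diag) ^+ d <=
  \sum_(B : {ffun 'I_d -> vec}) \prod_i (1%:M + overlap_mx B) i i.
Proof.
under eq_bigr => B _ do under eq_bigr => i _ do rewrite !mxE eqxx.
rewrite -(bigA_distr_bigA (fun (i : 'I_d) S => 1 + overlap S S)) /=.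
rewrite prodr_const card_ord -exprMn lerXn2r ?nnegrE//.
- by rewrite mulr_ge0 ?exprn_ge0// addr_ge0// mulr_ge0// sqrtr_ge0.
- apply: sumr_ge0 => S _; rewrite addr_ge0// overlap_diag.
  by rewrite mulr_ge0 ?invr_ge0// sumr_ge0.
rewrite big_split /= sumr_const card_ffun card_bool card_ord natrX mulrDr mulr1.
by rewrite lerD2l sum_overlap_diag.
Qed.

(** If s moves i, it also moves s i. These two factors are controlled in mean square, the other d -
    2 pointwise. *)
Lemma sum_prod_offdiag (s : 'S_d) : s != 1%g ->
  `|\sum_(B : {ffun 'I_d -> vec}) \prod_i (1%:M + overlap_mx B) i (s i)| <=
  (2 ^+ h) ^+ d * (1 + x) ^+ (d - 2).
Proof.
move=> s1; have [i si] : exists i, s i != i.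
  apply/existsP; apply: contraNT s1; rewrite negb_exists => /forallP fix_s.
  by apply/eqP/permP => i; rewrite perm1; apply/eqP; rewrite -[_ == _]negbK.
pose j := s i; have ji : j != i by [].
have sj : s j != j by rewrite (inj_eq perm_inj).
apply: le_trans (ler_norm_sum _ _ _) _; rewrite mulrC.
have bnd (B : {ffun 'I_d -> vec}) : `|\prod_i (1%:M + overlap_mx B) i (s i)| <=
    (1 + x) ^+ (d - 2) *
      ((overlap (B i) (B (s i)) ^+ 2 + overlap (B j) (B (s j)) ^+ 2) / 2).
  rewrite normr_prod (bigD1 i)//= (bigD1 j)//= [leLHS]mulrA [leLHS]mulrC.
  have x0 : 0 <= x by exact: sqrtr_ge0.
  apply: ler_pM => //; first by apply: prodr_ge0 => k _.
    have -> : (d - 2 = #|[pred k | (k != i) && (k != j)]|)%N.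
      rewrite -[in LHS](card_ord d) -(cardC (pred2 i j)) card2 eq_sym ji addKn.
      by apply: eq_card => k; rewrite !inE negb_or.
    rewrite -prodr_const; apply: ler_prod => k _; rewrite normr_ge0 /=.
    rewrite !mxE (le_trans (ler_normD _ _))// lerD ?overlap_le//.
    by case: (k == s k); rewrite ?normr1 ?normr0.
  have sif : (i == s i) = false by rewrite eq_sym (negbTE si).
  have sjf : (j == s j) = false by rewrite eq_sym (negbTE sj).
  rewrite !mxE sif sjf !add0r.
  (* AM-GM on the two factors at i and j = s i, both off the diagonal *)
  rewrite -(real_normK (num_real (overlap (B i) (B (s i))))).
  rewrite -(real_normK (num_real (overlap (B j) (B (s j))))).
  move: `|_| `|_| => u v; rewrite ler_pdivlMr// -subr_ge0.
  by rewrite (_ : _ - _ = (u - v) ^+ 2) ?sqr_ge0//; ring.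
apply: le_trans (ler_sum _ (fun B _ => bnd B)) _.
rewrite -mulr_sumr ler_wpM2l ?exprn_ge0 ?addr_ge0 ?sqrtr_ge0//.
rewrite -mulr_suml big_split /= ler_pdivrMr// -card_borders mulr_natr mulr2n.
by rewrite lerD// sum_sqr_overlap// eq_sym.
Qed.

Lemma exists_border_large_det : exists B : {ffun 'I_d -> vec},
  (1 + mean_diag) ^+ d - d`!.-1%:R * (1 + x) ^+ (d - 2) <=
  \det (1%:M + overlap_mx B).
Proof.
set L := _ - _; apply/existsP; rewrite -[[exists _, _]]negbK negb_exists.
apply/negP => /forallP small.
suff : \sum_(B : {ffun 'I_d -> vec}) \det (1%:M + overlap_mx B) >= (2 ^+ h) ^+ d * L.
  apply/negP; rewrite -ltNge -card_borders mulr_natl -sumr_const.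
  apply: ltr_sum => [|B _]; last by rewrite ltNge small.
  (* A strict inequality between the sums requires at least one border. *)
  by apply/hasP; exists [ffun=> [ffun=> true]]; rewrite ?mem_index_enum.
rewrite exchange_big (bigD1 1%g)//=.
under eq_bigr => B _ do under eq_bigr => i _ do rewrite perm1.
under eq_bigr => B _ do rewrite odd_perm1 expr0 mul1r.
rewrite /L mulrBr lerD ?sum_prod_diag// lerNl -sumrN mulrCA mulr_natl.
have -> : d`!.-1 = #|[pred s : 'S_d | s != 1%g]|.
  by rewrite -card_Sn -cardsT; have := cardC1 (1%g : 'S_d); rewrite cardsT => <-.
rewrite -sumr_const; apply: ler_sum => s s1.
rewrite -mulr_sumr (le_trans _ (sum_prod_offdiag s1))//.
by rewrite (le_trans (ler_norm _))// normrN normrM normrX normrN1 expr1n mul1r.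
Qed.

End RandomBorder.

(** * Elementary inequalities between powers *)

Lemma ler_subXX (R : realFieldType) (n : nat) (x y : R) : 0 <= y <= x ->
  n%:R * (x - y) * y ^+ n.-1 <= x ^+ n - y ^+ n.
Proof.
case/andP=> y0 yx; rewrite subrXX mulrAC mulrC ler_wpM2l ?subr_ge0//.
have -> : n%:R * y ^+ n.-1 = \sum_(i < n) y ^+ n.-1.
  by rewrite sumr_const card_ord mulr_natl.
apply: ler_sum => i _; have /subnK e : (i <= n.-1)%N by have := ltn_ord i; lia.
rewrite -[in leLHS]e exprD ler_wpM2r ?exprn_ge0// lerXn2r ?nnegrE//.
exact: le_trans yx.
Qed.

Lemma powR_half (R : realType) (a : R) (n : nat) : 0 <= a ->
  a `^ (n%:R / 2) = Num.sqrt a ^+ n.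
Proof.
by move=> a0; rewrite mulrC powRrM powR12_sqrt// powR_mulrn ?sqrtr_ge0.
Qed.

(** (1 + 1/x)^k <= exp(k/x) <= e: this is the source of the factor e in [h0]. *)
Lemma expr1D_le (R : realType) (x : R) (k : nat) : 0 < x -> k%:R <= x ->
  (1 + x) ^+ k <= expR 1 * x ^+ k.
Proof.
move=> x0 kx; have -> : 1 + x = (1 + x^-1) * x by field; rewrite gt_eqF.
rewrite exprMn ler_wpM2r ?exprn_ge0 ?(ltW x0)//.
apply: (@le_trans _ _ (expR x^-1 ^+ k)).
  rewrite lerXn2r ?nnegrE ?expR_ge0 ?expR_ge1Dx//.
  by rewrite addr_ge0// invr_ge0 ltW.
by rewrite -expRM_natl ler_expR ler_pdivrMr// mul1r.
Qed.

(** Used with d = k + 2, x = sqrt h, w = sqrt(pi/2), m = sqrt(2n/pi) and t the excess of the mean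
    diagonal entry over m. After multiplication by x w^(k+1), the two sides are separated by (k+2)!
    e x^(k+1) w^(k+2); strictness comes from (k+2)! - 1 < (k+2)!. *)
Lemma offdiag_lt_main (R : realFieldType) (k : nat) (e x w m t : R) :
  0 < e -> 0 < x -> 1 <= w -> x <= w * m ->
  e * w ^+ k.+2 * k.+1`!%:R <= x * t -> (1 + x) ^+ k <= e * x ^+ k ->
  (k.+2)`!.-1%:R * (1 + x) ^+ k < k.+2%:R * t * m ^+ k.+1.
Proof.
move=> e0 x0 w1 xwm et xk; have w0 : 0 < w by exact: lt_le_trans w1.
have c0 : 0 < x * w ^+ k.+1 by rewrite mulr_gt0// exprn_gt0.
rewrite -(ltr_pM2r c0); apply: (@lt_le_trans _ _
    (k.+2%:R * (e * w ^+ k.+2 * k.+1`!%:R) * x ^+ k.+1)); last first.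
  have -> : k.+2%:R * t * m ^+ k.+1 * (x * w ^+ k.+1) =
      k.+2%:R * (x * t) * (w * m) ^+ k.+1 by rewrite exprMn; ring.
  apply: ler_pM.
  - have F0 : 0 <= k.+1`!%:R :> R by [].
    by apply: mulr_ge0 => //; rewrite mulr_ge0// mulr_ge0 ?exprn_ge0// ltW.
  - by rewrite exprn_ge0// ltW.
  - by rewrite ler_wpM2l.
  - by rewrite lerXn2r ?nnegrE ?(ltW x0)// (le_trans (ltW x0)).
apply: (@le_lt_trans _ _ (k.+2`!.-1%:R * (e * x ^+ k) * (x * w ^+ k.+2))).
  apply: ler_pM; rewrite ?mulr_ge0 ?exprn_ge0 ?addr_ge0 ?(ltW x0) ?(ltW w0)//.
    by rewrite ler_wpM2l.
  by rewrite (ler_pM2l x0) ler_weXn2l.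
have -> : k.+2%:R * (e * w ^+ k.+2 * k.+1`!%:R) * x ^+ k.+1 =
    k.+2`!%:R * (e * x ^+ k) * (x * w ^+ k.+2).
  by rewrite (factS k.+1) natrM (exprS x k); ring.
have x1 : 0 < x * w ^+ k.+2 by rewrite mulr_gt0// exprn_gt0.
have x2 : 0 < e * x ^+ k by rewrite mulr_gt0// exprn_gt0.
rewrite (ltr_pM2r x1) (ltr_pM2r x2).
by rewrite ltr_nat prednK// fact_gt0.
Qed.

(** * The numerical comparison *)

Section Numeric.
Variables (R : realType) (d h : nat).
Hypothesis d_gt0 : (1 <= d)%N.
Hypothesis h_gt0 : (0 < h)%N.
Notation x := (Num.sqrt h%:R : R).
Notation w := (Num.sqrt (pi / 2) : R).
Notation m := (Num.sqrt (2 * (h + d)%:R / pi) : R).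

Let pih0 : 0 < pi / 2 :> R. Proof. by rewrite divr_gt0// pi_gt0. Qed.
Let pi0 : 0 < pi :> R. Proof. exact: pi_gt0. Qed.
Let x0 : 0 < x. Proof. by rewrite sqrtr_gt0 ltr0n. Qed.
Let xx : x ^+ 2 = h%:R. Proof. by rewrite sqr_sqrtr. Qed.
Let w0 : 0 < w. Proof. by rewrite sqrtr_gt0. Qed.
Let ww : w ^+ 2 = pi / 2. Proof. by rewrite sqr_sqrtr// ltW. Qed.

Lemma sqrt_pihalf_ge1 : 1 <= w.
Proof. by rewrite -[leLHS]sqrtr1 ler_wsqrtr// pihalf_ge1. Qed.

(** Multiplication by [w] removes pi: [w * m] is sqrt(h + d), and [w * mean_diag R h] below is h /
    sqrt(h + 1). *)
Lemma main_scaleE : (w * m) ^+ 2 = x ^+ 2 + d%:R.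
Proof.
rewrite exprMn ww sqr_sqrtr ?divr_ge0 ?mulr_ge0// ?ltW// xx natrD.
by move: pi pi0 => P P0; field; rewrite gt_eqF.
Qed.

Lemma mean_diagE : (w * mean_diag R h) ^+ 2 * (x ^+ 2 + 1) = x ^+ 4.
Proof.
rewrite !exprMn ww sqr_sqrtr ?divr_ge0 ?mulr_ge0// ?ltW//.
rewrite (exprM x 2 2) xx natr1; have := ltr0Sn R h.
by move: pi pi0 (h.+1%:R) => P P0 N N0; field; rewrite !gt_eqF.
Qed.

Lemma mean_diag_gap : x - d%:R <= x * (1 + mean_diag R h - m).
Proof.
set mu := mean_diag R h; have w1 := sqrt_pihalf_ge1.
(* sqrt (h + d) <= x + d / (2 x) and h / sqrt (h + 1) >= x - 1 / (2 x) *)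
have m_ub : 2 * x * (w * m) <= 2 * x ^+ 2 + d%:R.
  have := sqr_ge0 (w * m - x); rewrite sqrrB main_scaleE; lra.
have mu0 : 0 <= mu by rewrite mulr_ge0// sqrtr_ge0.
have x1 : 1 <= x ^+ 2 by rewrite xx ler1n.
have mu_lb : 2 * x ^+ 2 - 1 <= 2 * x * (w * mu).
  rewrite -ler_sqr ?nnegrE; last 2 first.
  - lra.
  - by rewrite !mulr_ge0// ltW.
  rewrite -(ler_pM2r (_ : 0 < x ^+ 2 + 1)); last lra.
  rewrite exprMn -[leRHS]mulrA mean_diagE.
  rewrite -subr_ge0 (_ : _ - _ = 3 * x ^+ 2 - 1); [lra | ring].
have d1 : 1 <= d%:R :> R by rewrite ler1n.
have : w * (x * (m - mu)) <= d%:R by lra.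
move=> le; have : x * (m - mu) <= d%:R; last by lra.
have [neg|pos] := leP (x * (m - mu)) 0; first by apply: le_trans neg _.
by apply: le_trans le; rewrite ler_peMl// ltW.
Qed.

Lemma mean_bound : h0 R d <= h%:R ->
  m ^+ d < (1 + mean_diag R h) ^+ d - d`!.-1%:R * (1 + x) ^+ (d - 2).
Proof.
rewrite /h0 powR_half ?(ltW pih0)// => hyp; set a := 1 + _.
set E := expR 1 * w ^+ d * d.-1`!%:R.
have E0 : 0 < E by rewrite !mulr_gt0 ?expR_gt0 ?exprn_gt0// ltr0n fact_gt0.
have Ed0 : 0 <= E + d%:R by rewrite addr_ge0// ltW.
(* The hypothesis on h after taking square roots; [mean_diag_gap] costs d and leaves E. *)
have Ex : E + d%:R <= x by rewrite -ler_sqr ?nnegrE ?(ltW x0) ?Ed0 ?xx.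
have gap : E <= x * (a - m) by apply: le_trans mean_diag_gap; lra.
have am : 0 < a - m by rewrite -(pmulr_rgt0 _ x0); exact: lt_le_trans gap.
have m0 : 0 <= m by exact: sqrtr_ge0.
have ma : 0 <= m <= a by rewrite m0 -subr_ge0 ltW.
rewrite ltrBrDr addrC -ltrBrDr; apply: lt_le_trans (ler_subXX d ma).
have xwm : x <= w * m.
  rewrite -ler_sqr ?nnegrE ?mulr_ge0 ?(ltW w0) ?(ltW x0)// main_scaleE.
  by rewrite lerDl.
have [k dk] : exists k, d = k.+1 by exists d.-1; rewrite prednK.
have dx : d%:R <= x by lra.
move: gap am xwm; rewrite /E; move: m => c; rewrite dk /= {hyp E E0 Ed0 Ex m0 ma}.
(* For d = 1 there is no permutation but the identity, so the correction is 0 and a > m suffices. *)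
case: k dk => [|k] dk gap am xwm.
  by rewrite (_ : 1`!.-1 = 0%N)// mul0r expr0 mulr1 mul1r.
rewrite subn2 /=; apply: (offdiag_lt_main (expR_gt0 1) x0 sqrt_pihalf_ge1 xwm gap).
by apply: expr1D_le => //; apply: le_trans dx; rewrite ler_nat dk; lia.
Qed.
End Numeric.

(** * Determinants in the unit box and of Hadamard matrices *)

(** Negating the first row stays in the box and flips the sign of the determinant. *)
Lemma norm_det_le_maxdet (R : realType) (n : nat) (A : 'M[R]_n) : (0 < n)%N ->
  unit_box A -> `|\det A| <= maxdet R n.
Proof.
case: n A => [//|n] A _ Abox; have [_ le_max] := maxdet_max R n.+1.
have [_|_] := ger0P (\det A); first exact: le_max.
pose D : 'rV[R]_n.+1 := \row_i (if i == 0 then -1 else 1).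
have -> : - \det A = \det (diag_mx D *m A).
  rewrite det_mulmx det_diag big_ord_recl big1 => [|i _]; rewrite mxE //.
  by rewrite eqxx mulr1 mulN1r.
apply: le_max => i j; rewrite mul_diag_mx !mxE; case: ifP => _.
  by rewrite mulN1r lerN2 lerNl andbC; exact: Abox.
by rewrite mul1r; exact: Abox.
Qed.

Lemma norm_det_hadamard (R : rcfType) (h : nat) (A : 'M[R]_h) :
  A *m A^T = h%:R%:M -> `|\det A| = Num.sqrt h%:R ^+ h.
Proof.
move/(congr1 determinant); rewrite det_mulmx det_tr det_scalar -expr2 => e.
apply/eqP; rewrite -(eqrXn2 (ltn0Sn 1)) ?exprn_ge0 ?sqrtr_ge0//.
by rewrite real_normK ?num_real// e exprAC sqr_sqrtr.
Qed.

(** * The bordered matrix *)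

Section Bordered.
Variables (R : realType) (d h : nat) (A : 'M[R]_h) (p : 'I_h -> 'I_h -> bool).
Hypothesis h_gt0 : (0 < h)%N.
Hypothesis A_sign : forall a k, A a k = (-1) ^+ p a k.
Hypothesis A_hadamard : A *m A^T = h%:R%:M.
Variable B : {ffun 'I_d -> {ffun 'I_h -> bool}}.

Definition bordered : 'M[R]_(h + d) :=
  block_mx A (\matrix_(a, j) (-1) ^+ B j a)
    (\matrix_(i, k) - sgproj A (B i) 0 k) 1%:M.

Lemma bordered_box : unit_box bordered.
Proof.
have sgn (b : bool) : -1 <= ((-1) ^+ b : R) <= 1.
  by case: b; rewrite ?expr1 ?expr0; lra.
move=> i j; case: (split_ordP i) => i' ->; case: (split_ordP j) => j' ->.
- by rewrite block_mxEul A_sign.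
- by rewrite block_mxEur mxE.
(* [Num.sg] may be 0 here, so these entries lie in the interval without always being signs. *)
- by rewrite block_mxEdl mxE -ler_norml normrN sgproj_le1.
- by rewrite block_mxEdr mxE; case: (_ == _); rewrite ?mulr1n ?mulr0n; lra.
Qed.

(** Block LU factorization with [V] = A^-1 [Bm], where A^-1 = A^T / h; the minus sign in the lower
    block turns the Schur complement into a sum. *)
Lemma det_bordered : \det bordered = \det A * \det (1%:M + overlap_mx A B).
Proof.
rewrite /bordered; set Bm := \matrix_(a, j) _; set C := \matrix_(i, k) _.
pose V := h%:R^-1 *: (A^T *m Bm).
have AV : A *m V = Bm.
  rewrite -scalemxAr mulmxA A_hadamard mul_scalar_mx scalerA mulVf ?scale1r//.
  by rewrite pnatr_eq0 -lt0n.
have CV : 1%:M - C *m V = 1%:M + overlap_mx A B.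
  congr (_ + _); apply/matrixP => i j; rewrite -scalemxAr mulmxA !mxE.
  rewrite /overlap -mulrN; congr (_ * _).
  rewrite /proj trmx_mul mulmxA !mxE -sumrN; apply: eq_bigr => a _.
  rewrite !mxE -mulNr; congr (_ * _); rewrite -sumrN.
  by apply: eq_bigr => k _; rewrite !mxE mulNr opprK.
have -> : block_mx A Bm C 1%:M =
    block_mx A 0 C 1%:M *m block_mx 1%:M V 0 (1%:M - C *m V).
  rewrite mulmx_block !mulmx0 !mul0mx !mulmx1 !mul1mx !addr0 AV.
  by rewrite addrC subrK.
by rewrite det_mulmx det_lblock det_ublock !det1 mulr1 mul1r CV.
Qed.

End Bordered.

Theorem theorem1 (R : realType) (d h n : nat) (hd : (1 <= d)%N)
    (hh : hadamard_order h) (hn : n = (h + d)%N) (hh0 : h0 R d <= h%:R) :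
  (2 * n%:R / pi) `^ (d%:R / 2) < maxdet R n / h%:R `^ (h%:R / 2) :> R.
Proof.
have [h_gt0 [H [Hsign HH]]] := hh; subst n.
pose A : 'M[R]_h := map_mx intr H; pose p a k := H a k == -1.
have A_sign a k : A a k = (-1) ^+ p a k.
  by rewrite mxE /p; case: (Hsign a k) => ->.
have A_hadamard : A *m A^T = h%:R%:M.
  have -> : A^T = map_mx intr H^T by apply/matrixP => i j; rewrite !mxE.
  by rewrite -map_mxM HH map_scalar_mx rmorph_nat.
have [B detB] := exists_border_large_det d h_gt0 A_sign A_hadamard.
have x0 : 0 < Num.sqrt h%:R ^+ h :> R by rewrite exprn_gt0// sqrtr_gt0 ltr0n.
(* Half-integer powers become powers of square roots, so that h^(h/2) is |det A| and cancels. *)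
rewrite !powR_half// ?divr_ge0 ?mulr_ge0 ?pi_ge0// ltr_pdivlMr//.
have lt_det := lt_le_trans (mean_bound hd h_gt0 hh0) detB.
have := norm_det_le_maxdet _ (bordered_box A_sign B).
rewrite det_bordered// normrM (norm_det_hadamard A_hadamard) addn_gt0 h_gt0.
move=> /(_ isT); apply: lt_le_trans; rewrite mulrC ltr_pM2l//.
exact: lt_le_trans lt_det (ler_norm _).
Qed.
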